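(* Let $\Delta$ be a fan in $N_{\mathbb{R}}$ satisfying the standing assumption (see context). Then there exists an inverse $\Delta$-system $\{\breve{M}_\sigma\}_{\sigma\in\Delta}$ of submonoids of $\breve{M}$ (i.e. $\breve{M}_\sigma\subset\breve{M}_\tau$ whenever $\tau\prec\sigma\in\Delta$) such that $\breve{M}_\sigma$ is admissible to $\sigma$ for all $\sigma\in\Delta$.
   Context: $N\simeq\mathbb{Z}^n$ is a lattice with fixed basis $(e_1,\ldots,e_n)$, $M=\mathrm{Hom}_{\mathbb{Z}}(N,\mathbb{Z})$ with dual basis $(e_1^*,\ldots,e_n^* )$, $N_{\mathbb{R}}=N\otimes\mathbb{R}$. $\Delta$ is a (finite) fan of rational strongly convex polyhedral cones in $N_{\mathbb{R}}$; $\tau\prec\sigma$ means $\tau$ is a proper face of $\sigma$. Standing assumption on $\Delta$: the cone generated by $e_1,\ldots,e_n$ is in $\Delta$, and every maximal cone of $\Delta$ is $n$-dimensional, simplicial and of index $1$ (generated by a $\mathbb{Z}$-basis of $N$). For $\sigma\in\Delta$, $M_\sigma=\sigma^\vee\cap M$. $\breve{M}=\langle e_1^*,(e_1^* )^{-1},\ldots,e_n^*,(e_n^* )^{-1}\rangle$ is the monoid generated by these letters subject only to $e_i^*(e_i^* )^{-1}=(e_i^* )^{-1}e_i^*=1$ (i.e. the free group on $e_1^*,\ldots,e_n^*$), and $\pi:\breve{M}\to M$ is the abelianization. A submonoid $\breve{M}'\subset\breve{M}$ is admissible to $\sigma\in\Delta$ if (0) $\breve{M}'$ is finitely generated; (1)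 $\pi$ restricts to a surjection $\breve{M}'\to M_\sigma$; (2) every $\breve{m}\in\breve{M}'$ with $\pi(\breve{m})$ invertible in $M_\sigma$ is invertible in $\breve{M}'$. *)

(* Defs.v *)
From HB Require Import structures.
From mathcomp Require Import all_boot all_order all_algebra.
From mathcomp Require Import all_classical all_reals.

Set Implicit Arguments.
Unset Strict Implicit.
Unset Printing Implicit Defensive.

Import Order.TTheory GRing.Theory Num.Theory.
Local Open Scope classical_set_scope.
Local Open Scope ring_scope.
Local Open Scope quotient_scope.

(* Through the fixed basis (e_i) of N and its dual basis (e_i^* ) of M, the
   lattices N and M are both identified with 'rV[int]_n, the spaces N_R and M_R
   with 'rV[R]_n, and the evaluation pairing M_R x N_R -> R with
   sum_i u_i x_i. *)
Section Cones.
Context {R : realType} {n : nat}.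
Implicit Types (sigma tau : set 'rV[R]_n) (u x : 'rV[R]_n).

Definition pairing u x : R := \sum_(i < n) u 0 i * x 0 i.

Definition real_of_lattice (v : 'rV[int]_n) : 'rV[R]_n := map_mx intr v.

Definition cone_generated_by k (v : 'I_k -> 'rV[int]_n) : set 'rV[R]_n :=
  [set x | exists2 c : 'I_k -> R, (forall j, 0 <= c j) &
           x = \sum_(j < k) c j *: real_of_lattice (v j)].

Definition rational_polyhedral sigma : Prop :=
  exists k (v : 'I_k -> 'rV[int]_n), sigma = cone_generated_by v.

Definition strongly_convex sigma : Prop :=
  forall x, sigma x -> sigma (- x) -> x = 0.

Definition dual_cone sigma : set 'rV[R]_n :=
  [set u | forall x, sigma x -> 0 <= pairing u x].

Definition face tau sigma : Prop :=
  exists2 u, dual_cone sigma u & tau = sigma `&` [set x | pairing u x = 0].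

Definition proper_face tau sigma : Prop := face tau sigma /\ tau <> sigma.

Definition dual_monoid sigma : set 'rV[int]_n :=
  [set m | dual_cone sigma (real_of_lattice m)].

Definition is_fan (Delta : set (set 'rV[R]_n)) : Prop :=
  [/\ finite_set Delta,
      forall sigma, Delta sigma ->
        rational_polyhedral sigma /\ strongly_convex sigma,
      forall sigma tau, Delta sigma -> face tau sigma -> Delta tau &
      forall sigma tau, Delta sigma -> Delta tau ->
        face (sigma `&` tau) sigma /\ face (sigma `&` tau) tau].

Definition maximal_cone (Delta : set (set 'rV[R]_n)) sigma : Prop :=
  Delta sigma /\ forall tau, Delta tau -> sigma `<=` tau -> tau = sigma.

End Cones.

Definition lattice_basis n (b : 'I_n -> 'rV[int]_n) : Prop :=
  forall v : 'rV[int]_n,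
    exists! c : 'rV[int]_n, v = \sum_(i < n) c 0 i *: b i.

Definition standard_basis n (i : 'I_n) : 'rV[int]_n := delta_mx 0 i.

(* A cone generated by a Z-basis of N is automatically n-dimensional,
   simplicial and of index 1, and conversely. *)
Definition standing_assumption (R : realType) n
    (Delta : set (set 'rV[R]_n)) : Prop :=
  Delta (cone_generated_by (@standard_basis n)) /\
  forall sigma, maximal_cone Delta sigma ->
    exists2 b : 'I_n -> 'rV[int]_n,
      lattice_basis b & sigma = cone_generated_by b.

(* The monoid generated by the letters e_i^* and (e_i^* )^-1 subject only to
   e_i^* (e_i^* )^-1 = (e_i^* )^-1 e_i^* = 1: words modulo the least congruence
   containing these relations.  The letter (i, true) stands for e_i^*, and
   (i, false) for (e_i^* )^-1. *)
Definition letter n := ('I_n * bool)%type.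

Inductive word_cong n : seq (letter n) -> seq (letter n) -> Prop :=
| WordCancel i b : word_cong [:: (i, b); (i, ~~ b)] [::]
| WordRefl w : word_cong w w
| WordSym w1 w2 : word_cong w1 w2 -> word_cong w2 w1
| WordTrans w1 w2 w3 :
    word_cong w1 w2 -> word_cong w2 w3 -> word_cong w1 w3
| WordCat w1 w2 w1' w2' :
    word_cong w1 w1' -> word_cong w2 w2' ->
    word_cong (w1 ++ w2) (w1' ++ w2').

Section FreeGroup.
Variable n : nat.

Definition word_eq : rel (seq (letter n)) := fun w1 w2 => `[< word_cong w1 w2 >].

Fact word_eq_refl : reflexive word_eq.
Proof. by move=> w; apply/asboolP; constructor. Qed.

Fact word_eq_sym : symmetric word_eq.
Proof. by move=> w1 w2; apply/asboolP/asboolP => /WordSym. Qed.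

Fact word_eq_trans : transitive word_eq.
Proof.
by move=> w2 w1 w3 /asboolP h12 /asboolP h23; apply/asboolP/(WordTrans h12).
Qed.

Canonical word_eq_equiv :=
  EquivRel word_eq word_eq_refl word_eq_sym word_eq_trans.

Definition free_group := {eq_quot word_eq}.
HB.instance Definition _ := Choice.on free_group.
HB.instance Definition _ := Quotient.on free_group.

Definition word_class (w : seq (letter n)) : free_group := \pi_free_group w.

Lemma word_classP w1 w2 : word_class w1 = word_class w2 <-> word_cong w1 w2.
Proof. by split => [/eqmodP/asboolP|h] //; apply/eqmodP/asboolP. Qed.

Lemma word_class_repr (x : free_group) : word_class (repr x) = x.
Proof. exact: reprK. Qed.

Lemma repr_word_class w : word_cong (repr (word_class w)) w.
Proof. by apply/word_classP; rewrite word_class_repr. Qed.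

Definition inv_word (w : seq (letter n)) : seq (letter n) :=
  rev [seq (l.1, ~~ l.2) | l <- w].

Lemma inv_word_cong w1 w2 :
  word_cong w1 w2 -> word_cong (inv_word w1) (inv_word w2).
Proof.
elim=> {w1 w2}.
- by move=> i b; rewrite /inv_word /= negbK; apply: WordCancel.
- by move=> w; apply: WordRefl.
- by move=> w1 w2 _; apply: WordSym.
- by move=> w1 w2 w3 _ h12 _; apply: WordTrans.
- move=> w1 w2 w1' w2' _ h1 _ h2; rewrite /inv_word !map_cat !rev_cat.
  exact: WordCat.
Qed.

Lemma inv_wordK : involutive inv_word.
Proof.
move=> w; rewrite /inv_word map_rev revK -map_comp map_id_in //.
by case=> i b _ /=; rewrite negbK.
Qed.

Lemma word_mulV w : word_cong (w ++ inv_word w) [::].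
Proof.
elim: w => [|[i b] w IHw]; first exact: WordRefl.
rewrite /inv_word map_cons rev_cons -cats1 -cat1s -catA (catA w).
apply: WordTrans (@WordCancel n i b).
rewrite -[X in word_cong _ X]/([:: (i, b)] ++ ([::] ++ [:: (i, ~~ b)])).
apply: WordCat (WordRefl _) _; exact: WordCat IHw (WordRefl _).
Qed.

Lemma word_mulVl w : word_cong (inv_word w ++ w) [::].
Proof. by rewrite -{2}(inv_wordK w); apply: word_mulV. Qed.

Definition free_mul (x y : free_group) := word_class (repr x ++ repr y).
Definition free_inv (x : free_group) := word_class (inv_word (repr x)).

Lemma free_mul_class w1 w2 :
  free_mul (word_class w1) (word_class w2) = word_class (w1 ++ w2).
Proof. by apply/word_classP; apply: WordCat; apply: repr_word_class. Qed.

Fact free_mulA : associative free_mul.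
Proof.
move=> x y z.
by rewrite -(word_class_repr x) -(word_class_repr y) -(word_class_repr z)
  !free_mul_class catA.
Qed.

Fact free_mul1 : left_id (word_class [::]) free_mul.
Proof. by move=> x; rewrite -(word_class_repr x) free_mul_class. Qed.

Fact free_mulr1 : right_id (word_class [::]) free_mul.
Proof. by move=> x; rewrite -(word_class_repr x) free_mul_class cats0. Qed.

Fact free_mulV : left_inverse (word_class [::]) free_inv free_mul.
Proof.
move=> x; rewrite -{2}(word_class_repr x) free_mul_class.
by apply/word_classP; apply: word_mulVl.
Qed.

Fact free_mulrV : right_inverse (word_class [::]) free_inv free_mul.
Proof.
move=> x; rewrite -{1}(word_class_repr x) free_mul_class.
by apply/word_classP; apply: word_mulV.
Qed.

HB.instance Definition _ := isGroup.Build free_group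
  free_mulA free_mul1 free_mulr1 free_mulV free_mulrV.

(* The abelianization pi : free_group -> M, sending e_i^* to the i-th vector of
   the dual basis; [abelianization_class] shows that it does not depend on the
   representative word. *)
Definition word_sum (w : seq (letter n)) : 'rV[int]_n :=
  \sum_(l <- w) (if l.2 then standard_basis l.1 else - standard_basis l.1).

Definition abelianization (x : free_group) : 'rV[int]_n := word_sum (repr x).

Lemma word_sum_cong w1 w2 : word_cong w1 w2 -> word_sum w1 = word_sum w2.
Proof.
rewrite /word_sum; elim=> {w1 w2} //.
- move=> i b; rewrite !big_cons !big_nil addr0 /=.
  by case: b; rewrite /= ?subrr ?addNr.
- by move=> w1 w2 w3 _ -> _ ->.
- by move=> w1 w2 w1' w2' _ h1 _ h2; rewrite !big_cat /= h1 h2.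
Qed.

Lemma abelianization_class w : abelianization (word_class w) = word_sum w.
Proof. exact/word_sum_cong/repr_word_class. Qed.

Lemma abelianization1 : abelianization 1%g = 0.
Proof. by rewrite abelianization_class /word_sum big_nil. Qed.

Lemma abelianizationM (x y : free_group) :
  abelianization (x * y)%g = abelianization x + abelianization y.
Proof. by rewrite abelianization_class /word_sum big_cat. Qed.

End FreeGroup.

Definition submonoid (G : monoidType) (A : set G) : Prop :=
  A 1%g /\ forall x y, A x -> A y -> A (x * y)%g.

Definition finitely_generated (G : monoidType) (A : set G) : Prop :=
  exists2 S : set G, finite_set S & A = smallest (@submonoid G) S.

Definition admissible (R : realType) n (sigma : set 'rV[R]_n)
    (A : set (free_group n)) : Prop :=
  [/\ submonoid A,
      finitely_generated A,
      @abelianization n @` A = dual_monoid sigma &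
      forall x, A x ->
        (exists2 m, dual_monoid sigma m & abelianization x + m = 0) ->
        exists2 y, A y & (x * y = 1 /\ y * x = 1)%g].

Definition inverse_system (R : realType) n (Delta : set (set 'rV[R]_n))
    (Mon : set 'rV[R]_n -> set (free_group n)) : Prop :=
  (forall sigma, Delta sigma -> submonoid (Mon sigma)) /\
  forall sigma tau, Delta sigma -> proper_face tau sigma ->
    Mon sigma `<=` Mon tau.

(* Main.v *)
Require Import Defs.
From mathcomp Require Import all_boot all_order all_algebra.
From mathcomp Require Import all_classical all_reals.

(* Each dual monoid [M_sigma] has a finite generating set.  Lift all these
   generators to the free group and close the resulting finite set [T] under
   inversion.  The monoid attached to [sigma] is generated by those [t \in T]
   whose abelianization lies in [M_sigma].  If a product of such elements maps
   to a unit of [M_sigma], then so does every factor [t], hence [t^-1] is again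
   one of the generators. *)

Set Implicit Arguments.
Unset Strict Implicit.
Unset Printing Implicit Defensive.

Import Order.TTheory GRing.Theory Num.Theory.
Local Open Scope classical_set_scope.
Local Open Scope ring_scope.

(** Used to place each cone of a fan inside a maximal one. Scanning an enumeration of [D], the
    current candidate is replaced whenever the next set contains it. *)
Lemma finite_set_maximal_above {T : Type} (D : set (set T)) (A : set T) :
  finite_set D -> D A ->
  exists B, [/\ D B, A `<=` B & forall C, D C -> B `<=` C -> C = B].
Proof.
move=> /finite_seqP[s ->] sA.
(* Membership of [A] in the list does not pass to its tail, so the induction allows [B = A] as a
   separate case. *)
suff [B [sB AB maxB]] : exists B, [/\ B = A \/ B \in s, A `<=` B &
    forall C, C \in s -> B `<=` C -> C = B].
  by exists B; split=> //; case: sB => [->|].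
elim: s {sA} => [|C s [B [sB AB maxB]]]; first by exists A; split=> //; left.
have [BC|nBC] := pselect (B `<=` C).
  exists C; split; [by right; rewrite mem_head | exact: subset_trans BC |].
  move=> E; rewrite inE => /orP[/eqP->//|sE] CE.
  have EB := maxB _ sE (subset_trans BC CE).
  by apply/seteqP; split=> //; rewrite EB.
exists B; split=> //.
  by case: sB => [|sB]; [left | right; rewrite inE sB orbT].
by move=> E; rewrite inE => /orP[/eqP->//|/maxB].
Qed.

Lemma submonoid_smallest (G : monoidType) (S : set G) :
  submonoid (smallest (@submonoid G) S).
Proof.
split=> [A [[A1 _] _]//|x y Sx Sy A SA].
by case: (SA) => -[_ AM] _; apply: AM; [apply: Sx | apply: Sy].
Qed.

Definition sum_closed (V : zmodType) (A : set V) : Prop :=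
  A 0 /\ forall x y, A x -> A y -> A (x + y).

Section Abelianization.
Context {n : nat}.
Implicit Types x y : free_group n.

Lemma abelianizationV x : abelianization (x^-1)%g = - abelianization x.
Proof.
apply/eqP; rewrite -addr_eq0 -abelianizationM mulVg.
by rewrite abelianization1.
Qed.

Lemma abelianization_surj v : exists x, @abelianization n x = v.
Proof.
rewrite (row_sum_delta v).
elim/big_ind: _ => [|_ _ [x <-] [y <-]|i _].
- by exists 1%g; rewrite abelianization1.
- by exists (x * y)%g; rewrite abelianizationM.
have natE k : exists x, @abelianization n x = delta_mx 0 i *+ k.
  elim: k => [|k [x xE]]; first by exists 1%g; rewrite abelianization1.
  exists (word_class [:: (i, true)] * x)%g.
  by rewrite abelianizationM abelianization_class /word_sum big_seq1 xE mulrS.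
rewrite -[v 0 i]intz scaler_int; case: (v 0 i) => k; first exact: natE.
have [x xE] := natE k.+1.
by exists (x^-1)%g; rewrite abelianizationV xE NegzE mulrNz.
Qed.

End Abelianization.

Section Cones.
Context {R : realType} {n : nat}.
Implicit Types (sigma tau : set 'rV[R]_n) (u v x : 'rV[R]_n).

Lemma pairingE u x : pairing u x = (u *m x^T) 0 0.
Proof. by rewrite mxE; apply: eq_bigr => i _; rewrite mxE. Qed.

Lemma pairingDl u v x : pairing (u + v) x = pairing u x + pairing v x.
Proof. by rewrite !pairingE mulmxDl mxE. Qed.

Lemma pairing0l x : pairing 0 x = 0.
Proof. by rewrite pairingE mul0mx mxE. Qed.

Lemma pairingNl u x : pairing (- u) x = - pairing u x.
Proof. by rewrite !pairingE mulNmx mxE. Qed.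

Lemma pairingZr u a x : pairing u (a *: x) = a * pairing u x.
Proof. by rewrite !pairingE linearZ /= -scalemxAr mxE. Qed.

Lemma pairing_sumr u (I : finType) (f : I -> 'rV[R]_n) :
  pairing u (\sum_i f i) = \sum_i pairing u (f i).
Proof.
rewrite pairingE linear_sum mulmx_sumr summxE.
by apply: eq_bigr => i _; rewrite pairingE.
Qed.

Lemma pairing_real_of_lattice (d b : 'rV[int]_n) :
  pairing (real_of_lattice d) (real_of_lattice b) = ((d *m b^T) 0 0)%:~R :> R.
Proof. by rewrite pairingE /real_of_lattice map_trmx -map_mxM mxE. Qed.

Lemma dual_monoid_sum_closed sigma : sum_closed (dual_monoid sigma).
Proof.
split=> [x _|a b Ma Mb x sx].
  by rewrite /real_of_lattice map_mx0 pairing0l.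
by rewrite /real_of_lattice map_mxD pairingDl addr_ge0 ?Ma ?Mb.
Qed.

Lemma dual_monoidS sigma tau :
  tau `<=` sigma -> dual_monoid sigma `<=` dual_monoid tau.
Proof. by move=> ts m Mm x /ts; apply: Mm. Qed.

(** Expanding the standard vectors in the basis gives a left inverse [D] of the matrix [B] with rows
    [b i]. Over a commutative ring it is two-sided, and its columns form the dual basis. *)
Lemma lattice_basis_dual (b : 'I_n -> 'rV[int]_n) : lattice_basis b ->
  exists d : 'I_n -> 'rV[int]_n,
    (forall j k, (d j *m (b k)^T) 0 0 = (j == k)%:R) /\
    forall m, m = \sum_j (m *m (b j)^T) 0 0 *: d j.
Proof.
move=> bB; pose B := \matrix_i b i.
have /choice[c cE] : forall i : 'I_n, exists c : 'rV[int]_n,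
    delta_mx 0 i = c *m B.
  move=> i; have [c [cE _]] := bB (delta_mx 0 i).
  exists c; rewrite cE mulmx_sum_row.
  by apply: eq_bigr => j _; rewrite rowK.
pose D := \matrix_i c i.
have DB : D *m B = 1%:M.
  by apply/row_matrixP => i; rewrite row_mul rowK -cE row1.
have BD := mulmx1C DB.
exists (fun j => row j D^T); split=> [j k|m].
  transitivity ((D^T *m B^T) j k).
    by rewrite !mxE; apply: eq_bigr => i _; rewrite !mxE.
  by rewrite -trmx_mul BD trmx1 mxE.
rewrite -[LHS]mulmx1 -trmx1 -DB trmx_mul mulmxA mulmx_sum_row.
apply: eq_bigr => j _; congr (_ *: _).
by rewrite !mxE; apply: eq_bigr => i _; rewrite !mxE.
Qed.

(** Generation is phrased as an induction principle, so that it applies directly to the image of a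
    submonoid of the free group. *)
Definition sum_generates (V : zmodType) (S A : set V) : Prop :=
  S `<=` A /\ forall P, sum_closed P -> S `<=` P -> A `<=` P.

(* Gordan's lemma in the special case needed here: [u] cuts out [tau] from a
   cone with basis [b], so that the dual basis vector [d j] vanishes on [tau]
   as soon as [u] does not vanish at [b j]. *)
Lemma dual_monoid_finitely_generated (b : 'I_n -> 'rV[int]_n) tau :
  lattice_basis b -> face tau (cone_generated_by b) ->
  exists2 S, finite_set S & sum_generates S (dual_monoid tau).
Proof.
move=> /lattice_basis_dual[d [db mE]] [u u_ge0 tauE].
exists ((range d `|` [set - d j | j in setT]) `&` dual_monoid tau).
  apply: sub_finite_set (@subIsetl _ _ _) _.
  by rewrite finite_setU; split; apply: finite_image; exact: finite_finset.
split=> [|P [P0 PD] SP m Mm]; first exact: subIsetr.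
have sb j : cone_generated_by b (real_of_lattice (b j) : 'rV[R]_n).
  exists (fun k => (k == j)%:R) => [k|]; first exact: ler0n.
  rewrite (bigD1 j) //= eqxx scale1r big1 ?addr0 // => k /negbTE->.
  by rewrite scale0r.
have d_coord j (c : 'I_n -> R) :
    pairing (real_of_lattice (d j)) (\sum_k c k *: real_of_lattice (b k)) = c j.
  rewrite pairing_sumr (bigD1 j) //= pairingZr pairing_real_of_lattice db eqxx.
  rewrite mulr1 big1 ?addr0 // => k jk.
  by rewrite pairingZr pairing_real_of_lattice db eq_sym (negbTE jk) mulr0.
have Md j : dual_monoid tau (d j).
  by move=> x; rewrite tauE => -[[c c0 ->] _]; rewrite d_coord.
have Pd j : P (d j) by apply: SP; split=> //; left; exists j.
have PMn (k : nat) (v : 'rV[int]_n) : P v -> P (v *+ k).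
  by move=> Pv; elim: k => [|k IHk]; rewrite ?mulr0n // mulrS; apply: PD.
(* In dual coordinates [m] is the sum of the [d j] weighted by its values at the [b j]; each term is
   treated separately. *)
rewrite (mE m); elim/big_ind: _ => // j _.
rewrite -[(m *m _) 0 0]intz scaler_int.
(* If [u] vanishes at [b j], then [b j] lies in [tau], so the coefficient is nonnegative and [d j]
   suffices. Otherwise [- d j] is a generator too and the sign is irrelevant. *)
have [ubj|ubj] := eqVneq (pairing u (real_of_lattice (b j))) 0.
  have : 0 <= (m *m (b j)^T) 0 0.
    rewrite -(ler0z R) -pairing_real_of_lattice; apply: Mm.
    by rewrite tauE; split.
  by case: ((m *m _) 0 0) => k // _; apply: PMn.
have PNd : P (- d j).
  apply: SP; split; first by right; exists j.
  rewrite /dual_monoid /= => x; rewrite tauE => -[[c c0 ->] /= ux].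
  have -> : real_of_lattice (- d j) = - real_of_lattice (d j) :> 'rV[R]_n.
    by rewrite /real_of_lattice map_mxN.
  rewrite pairingNl d_coord oppr_ge0.
  (* On [tau] the nonnegative terms [c k * pairing u (b k)] sum to zero, hence all vanish. *)
  suff /eqP : c j * pairing u (real_of_lattice (b j)) = 0.
    by rewrite mulf_eq0 (negbTE ubj) orbF => /eqP->.
  apply: (psumr_eq0P (P := xpredT)
    (F := fun k => c k * pairing u (real_of_lattice (b k)))) => // [k _|].
    by rewrite mulr_ge0 // u_ge0.
  by rewrite -[RHS]ux pairing_sumr; apply: eq_bigr => k _; rewrite pairingZr.
case: ((m *m _) 0 0) => k; first exact: PMn.
by rewrite NegzE mulrNz -mulNrn; apply: PMn.
Qed.

(** A maximal cone containing [tau] has a lattice basis, and [tau], being its intersection with that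
    cone, is a face of it by the fan axiom. *)
Lemma fan_dual_monoid_finitely_generated (Delta : set (set 'rV[R]_n)) tau :
  is_fan Delta -> standing_assumption Delta -> Delta tau ->
  exists2 S, finite_set S & sum_generates S (dual_monoid tau).
Proof.
move=> [finD _ _ capD] [_ maxD] Dtau.
have [sigma [Ds ts maxs]] := finite_set_maximal_above finD Dtau.
have [b bB sE] : exists2 b, lattice_basis b & sigma = cone_generated_by b.
  exact: maxD.
apply: (dual_monoid_finitely_generated bB); rewrite -sE.
by have [+ _] := capD _ _ Ds Dtau; rewrite setIidr.
Qed.

(** Sharing one [T] among all cones makes the construction order-reversing in [sigma], which yields
    the inverse system. *)
Definition monoid_over (T : set (free_group n)) sigma : set (free_group n) :=
  smallest (@submonoid (free_group n))
    (T `&` @abelianization n @^-1` dual_monoid sigma).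

Lemma abelianization_monoid_over T sigma (x : free_group n) :
  monoid_over T sigma x -> dual_monoid sigma (abelianization x).
Proof.
have [M0 MD] := dual_monoid_sum_closed sigma.
apply: (_ : _ `<=` @abelianization n @^-1` dual_monoid sigma).
apply: smallest_sub; last exact: subIsetr.
split=> [|y z /= My Mz]; rewrite /= ?abelianization1 // abelianizationM.
exact: MD.
Qed.

Lemma admissible_monoid_over T sigma (S : set 'rV[int]_n) :
  finite_set T -> (forall t, T t -> T (t^-1)%g) ->
  S `<=` @abelianization n @` T -> sum_generates S (dual_monoid sigma) ->
  admissible sigma (monoid_over T sigma).
Proof.
move=> finT TV ST [SM genS].
have [_ MD] := dual_monoid_sum_closed sigma.
have [A1 AM] := submonoid_smallest
  (T `&` @abelianization n @^-1` dual_monoid sigma).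
have genA := @sub_gen_smallest _ (@submonoid (free_group n))
  (T `&` @abelianization n @^-1` dual_monoid sigma).
split; first by split.
- exists (T `&` @abelianization n @^-1` dual_monoid sigma) => //.
  exact: sub_finite_set (@subIsetl _ _ _) finT.
- apply/seteqP; split=> [y [x Ax <-]|].
    exact: abelianization_monoid_over Ax.
  (* The image of the monoid is sum-closed, so it is enough to reach the elements of [S], which lift
     to [T]. *)
  apply: genS => [|s Ss].
    split=> [|_ _ [x Ax <-] [y Ay <-]].
      by exists 1%g; [exact: A1 | exact: abelianization1].
    by exists (x * y)%g; [exact: AM | exact: abelianizationM].
  have [t Tt tE] := ST _ Ss; exists t => //; apply: genA; split=> //=.
  by rewrite tE; apply: SM.
pose A := monoid_over T sigma.
(* The unit condition is recast as a property stable under products, so that it can be checked on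
   generators. *)
pose U := [set x : free_group n | A x /\
  (dual_monoid sigma (- abelianization x) -> A (x^-1)%g)].
have AU : A `<=` U.
  apply: smallest_sub => [|t Tt].
    split=> [|x y [Ax Vx] [Ay Vy]]; first by split=> [|_]; rewrite ?invg1.
    split=> [|]; first exact: AM.
    rewrite abelianizationM opprD invgM => Mxy.
    have Mx := abelianization_monoid_over Ax.
    have My := abelianization_monoid_over Ay.
    apply: AM; [apply: Vy | apply: Vx].
      (* Factors of a unit are units: with [a] and [b] the images of [x] and [y],
         [- b = a + (- a - b)] and [- a = (- a - b) + b]. *)
      by rewrite -[X in dual_monoid _ X](addNKr (abelianization x)); exact: MD.
    by rewrite -[X in dual_monoid _ X](addrNK (abelianization y)); exact: MD.
  split=> [|MNt]; first exact: genA.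
  apply: genA; split; first by apply: TV; case: Tt.
  by rewrite /= abelianizationV.
move=> x /AU[Ax Vx] [m Mm xm]; exists (x^-1)%g; last by rewrite mulgV mulVg.
by apply: Vx; move/eqP: xm; rewrite addrC addr_eq0 => /eqP <-.
Qed.

End Cones.

Theorem theorem2p2p5 (R : realType) (n : nat) (Delta : set (set 'rV[R]_n)) :
  is_fan Delta -> standing_assumption Delta ->
  exists Mon : set 'rV[R]_n -> set (free_group n),
    inverse_system Delta Mon /\
    forall sigma, Delta sigma -> admissible sigma (Mon sigma).
Proof.
move=> fanD stdD; have [finD _ _ _] := fanD.
have /choice[S SP] : forall sigma : set 'rV[R]_n, exists S : set 'rV[int]_n,
    Delta sigma -> finite_set S /\ sum_generates S (dual_monoid sigma).
  (* Choice needs a value at every set; outside [Delta] the empty set serves as a default. *)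
  move=> sigma; have [Ds|nDs] := pselect (Delta sigma); last by exists set0.
  have [S finS genS] := fan_dual_monoid_finitely_generated fanD stdD Ds.
  by exists S.
have /choice[lift liftK] := @abelianization_surj n.
(* Generators for all cones are lifted at once; finiteness of the fan keeps [T] finite. *)
pose L := lift @` \bigcup_(sigma in Delta) S sigma.
pose T := L `|` [set (x^-1)%g | x in L].
have finT : finite_set T.
  have finL : finite_set L.
    by apply/finite_image/bigcup_finite => // sigma /SP[].
  by rewrite finite_setU; split=> //; apply: finite_image.
have TV t : T t -> T (t^-1)%g.
  by case=> [Lt|[x Lx <-]]; [right; exists t | left; rewrite invgK].
exists (monoid_over T); split; first split.
- by move=> sigma _; exact: submonoid_smallest.
(* A face has a larger dual monoid, hence retains more elements of [T] as generators. *)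
- move=> sigma tau _ [[u _ tauE] _]; apply: sub_smallest2r.
    exact: submonoid_smallest.
  by apply: setIS => x; apply: dual_monoidS; rewrite tauE; exact: subIsetl.
move=> sigma Ds; have [_ genS] := SP _ Ds.
apply: admissible_monoid_over finT TV _ genS => s Ss.
by exists (lift s) => //; left; exists s => //; exists sigma.
Qed.
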